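(* For all positive integers $a,b$, $$\mathbf{ex}(a,b,Q)\leq 2^{1/5}(ab)^{4/5}+9\left(ab^{1/2}+a^{1/2}b\right),$$ and for all positive integers $n$, $$\mathbf{ex}(n,Q)\leq 2^{-2/5}n^{8/5}+13n^{3/2}.$$
   Context: Graphs are finite and simple. The cube $Q$ is the usual $8$-vertex, $3$-regular graph formed by the $12$ edges of the three-dimensional cube (vertices are the $0$-$1$ vectors of length $3$, two adjacent if and only if they differ in exactly one coordinate). A graph is $H$-free if it does not contain $H$ as a (not necessarily induced) subgraph. $\mathbf{ex}(n,H)$ denotes the maximum number of edges of an $H$-free graph on $n$ vertices. $\mathbf{ex}(a,b,H)$ denotes the maximum number of edges in an $H$-free subgraph of the complete bipartite graph $K_{a,b}$ with parts of sizes $a$ and $b$. *)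

(* Defs.v *)
From mathcomp Require Import all_boot.

Set Implicit Arguments.
Unset Strict Implicit.
Unset Printing Implicit Defensive.

(* A graph on the vertex type T is given by its edge set E : {set {set T}};
   an edge is the unordered pair of its ends, so #|E| is the number of edges. *)
Definition simple_graph (T : finType) (E : {set {set T}}) : bool :=
  [forall e in E, #|e| == 2].

(* Not necessarily induced: edges of H are mapped to edges of E, non-edges are
   unconstrained. *)
Definition contains (V T : finType) (H : {set {set V}}) (E : {set {set T}}) :
    bool :=
  [exists f : {ffun V -> T}, injectiveb f && [forall e in H, f @: e \in E]].

Definition free (V T : finType) (H : {set {set V}}) (E : {set {set T}}) : bool :=
  ~~ contains H E.

Definition turan (V : finType) (n : nat) (H : {set {set V}}) : nat :=
  \max_(E : {set {set 'I_n}} | simple_graph E && free H E) #|E|.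

Definition complete_bipartite (a b : nat) : {set {set ('I_a + 'I_b)}} :=
  [set [set inl i; inr j] | i in 'I_a, j in 'I_b].

(* Taking only spanning subgraphs of K_{a,b} loses nothing: restoring isolated
   vertices to a subgraph creates no copy of a graph without isolated vertices
   and does not change the number of edges. *)
Definition turan_bip (V : finType) (a b : nat) (H : {set {set V}}) : nat :=
  \max_(E : {set {set ('I_a + 'I_b)}} |
      (E \subset complete_bipartite a b) && free H E) #|E|.

Definition cube_adj : rel {ffun 'I_3 -> bool} :=
  fun x y => #|[set i | x i != y i]| == 1.

Definition cube : {set {set {ffun 'I_3 -> bool}}} :=
  [set [set p.1; p.2] | p : {ffun 'I_3 -> bool} * {ffun 'I_3 -> bool}
                      & cube_adj p.1 p.2].

(* Main.v *)
Require Import Defs.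
From mathcomp Require Import all_boot all_order all_algebra.
From mathcomp Require Import reals exp.
From mathcomp Require Import zify ring lra.

(* Counting paths with three edges, twice.
   In a bipartite hexagon-free graph, the middle edges of the paths x v u y with
   fixed ends x and y pairwise intersect, hence form a star. If one only counts
   paths in which y and v, as well as x and u, have at most two common
   neighbours, there are at most two of them for each (x, y), while every edge
   uv is the middle of at least (d(u) - 2)(d(v) - 2) of them. After deleting two
   edges at each vertex, Sidorenko's inequality for the three-edge path gives
   (e - 2a - 2b)^3 <= 2(ab)^2.
   In a bipartite cube-free graph, the graph between N(y) - x and N(x) - y is
   hexagon-free for all x, y, so has at most 2^(1/3) (d(x)d(y))^(2/3)
   + 2(d(x) + d(y)) edges; summing over (x, y) bounds the number of three-edge
   walks, which is at least e^3/(ab).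
   A graph has a cut with at least half of its edges, and the bound for parts
   a + b = n is largest when a = b. *)

Set Implicit Arguments.
Unset Strict Implicit.
Unset Printing Implicit Defensive.

Import Order.TTheory GRing.Theory Num.Theory.

(** * Bipartite graphs as relations, with degrees and edge counts *)

Definition flip (A B : Type) (g : A -> B -> bool) : B -> A -> bool :=
  fun v u => g u v.

Definition deg (A : Type) (B : finType) (g : A -> B -> bool) (u : A) : nat :=
  \sum_(v : B) g u v.

Definition nedges (A B : finType) (g : A -> B -> bool) : nat :=
  \sum_(u : A) deg g u.

Definition hexagon_free (A B : eqType) (g : A -> B -> bool) : Prop :=
  forall u1 u2 u3 v1 v2 v3, uniq [:: u1; u2; u3] -> uniq [:: v1; v2; v3] ->
    g u1 v1 -> g u1 v2 -> g u2 v2 -> g u2 v3 -> g u3 v3 -> g u3 v1 -> False.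

Lemma hexagon_free_flip (A B : eqType) (g : A -> B -> bool) :
  hexagon_free g -> hexagon_free (flip g).
Proof.
move=> gF v1 v2 v3 u1 u2 u3 Uv Uu h11 h12 h22 h23 h33 h31.
apply: (gF u2 u3 u1 v1 v2 v3) => //.
by move: Uu; rewrite /= !inE (eq_sym u2 u1) (eq_sym u3 u1); case: (u1 == u2);
   case: (u1 == u3); case: (u2 == u3).
Qed.

Lemma nedges_flip (A B : finType) (g : A -> B -> bool) :
  nedges (flip g) = nedges g.
Proof. by rewrite /nedges /deg exchange_big. Qed.

Lemma deg_card (A : Type) (B : finType) (g : A -> B -> bool) u :
  deg g u = #|[set v | g u v]|.
Proof.
rewrite -sum1_card /deg [RHS]big_mkcond; apply: eq_bigr => v _.
by rewrite inE; case: (g u v).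
Qed.

Lemma deg_gt0 (A : Type) (B : finType) (g : A -> B -> bool) u v :
  g u v -> (0 < deg g u)%N.
Proof. by move=> h; rewrite deg_card (cardD1 v) inE h. Qed.

(** * A lower bound for the number of three-edge walks *)

Section Walks.
Variable F : realFieldType.
Local Open Scope ring_scope.

(** The arithmetic-geometric mean inequality for [s t], [1/s] and [1/t], whose product is 1. *)
Lemma agm_three (s t : F) : 0 < s -> 0 < t -> 3 <= s * t + s^-1 + t^-1.
Proof.
move=> s0 t0.
have h : 3 * (s * t) <= (s * t) ^+ 2 + t + s.
  have [t4|t4] := lerP 4^-1 t; last by nra.
  (* This is [4 t^2] times the difference of the sides, after completing the square in [s]. The part
     free of [s] factors as [(4 t - 1) (1 - t)^2], hence the split at [t = 1/4]. *)
  have : 0 <= (2 * t ^+ 2 * s + (1 - 3 * t)) ^+ 2 + (4 * t - 1) * (1 - t) ^+ 2.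
    apply: addr_ge0; first exact: sqr_ge0.
    by apply: mulr_ge0; [lra|exact: sqr_ge0].
  have -> : (2 * t ^+ 2 * s + (1 - 3 * t)) ^+ 2 + (4 * t - 1) * (1 - t) ^+ 2
     = (4 * t ^+ 2) * ((s * t) ^+ 2 + t + s - 3 * (s * t)) by ring.
  by rewrite pmulr_rge0 ?subr_ge0 // mulr_gt0 // exprn_gt0.
have st0 : 0 < s * t by rewrite mulr_gt0.
rewrite -(ler_pM2r st0); apply: le_trans h _.
rewrite le_eqVlt; apply/orP; left; apply/eqP; field.
by rewrite !gt_eqF.
Qed.

(** A vertex of positive degree contributes exactly 1, an isolated one 0. *)
Lemma sum_inv_deg (A B : finType) (g : A -> B -> bool) :
  \sum_u \sum_v (g u v)%:R / (deg g u)%:R <= #|A|%:R :> F.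
Proof.
rewrite -sum1_card natr_sum; apply: ler_sum => u _.
rewrite -mulr_suml -natr_sum -/(deg g u).
have [->|d0] := eqVneq (deg g u) 0%N; first by rewrite mul0r.
by rewrite divff // pnatr_eq0.
Qed.

(** For every edge, [agm_three] is applied to the degrees of its ends divided by the average degrees
    [al] and [be]. By [sum_inv_deg] the reciprocal terms add up to at most [al s + be t = 2 e],
    which leaves [e <= W / (al be)]. *)
Lemma nedges_walks_field (A B : finType) (g : A -> B -> bool) :
  (nedges g)%:R ^+ 3 <= #|A|%:R * #|B|%:R *
    \sum_u \sum_v (g u v)%:R * ((deg g u)%:R * (deg (flip g) v)%:R) :> F.
Proof.
set e : F := (nedges g)%:R; set W := \sum_u _.
have [e0|e0] := eqVneq (nedges g) 0%N.
  rewrite /e e0 expr0n /=; apply: mulr_ge0; first by rewrite mulr_ge0.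
  by apply: sumr_ge0 => u _; apply: sumr_ge0 => v _; rewrite !mulr_ge0.
have eE : e = \sum_u \sum_v (g u v)%:R.
  by rewrite /e /nedges natr_sum; apply: eq_bigr => u _; rewrite natr_sum.
have egt : 0 < e by rewrite /e ltr0n lt0n.
have A0 : 0 < #|A|%:R :> F.
  rewrite ltr0n lt0n; apply: contraNneq e0 => /card0_eq A0.
  by rewrite /nedges big1 // => u; have := A0 u; rewrite inE.
have B0 : 0 < #|B|%:R :> F.
  rewrite ltr0n lt0n; apply: contraNneq e0 => /card0_eq B0.
  rewrite -nedges_flip /nedges big1 // => u; have := B0 u; by rewrite inE.
set s := #|A|%:R in A0 *; set t := #|B|%:R in B0 *.
pose al := e / s; pose be := e / t.
have al0 : 0 < al by rewrite divr_gt0.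
have be0 : 0 < be by rewrite divr_gt0.
have key : 3 * e <= W / (al * be) + al * s + be * t.
  apply: (@le_trans _ _ (W / (al * be)
      + al * (\sum_u \sum_v (g u v)%:R / (deg g u)%:R)
      + be * (\sum_u \sum_v (flip g u v)%:R / (deg (flip g) u)%:R))); last first.
    apply: lerD; first apply: lerD => //.
      by rewrite ler_pM2l //; apply: sum_inv_deg.
    by rewrite ler_pM2l //; apply: sum_inv_deg.
  rewrite [X in be * X]exchange_big /= eE mulr_sumr /W mulr_suml !mulr_sumr.
  rewrite -!big_split /=; apply: ler_sum => u _.
  rewrite !mulr_sumr !mulr_suml -!big_split /=; apply: ler_sum => v _.
  rewrite -[flip g v u]/(g u v); case guv: (g u v); last by rewrite !mul0r !mulr0 !addr0.
  have du : 0 < (deg g u)%:R :> F by rewrite ltr0n (deg_gt0 guv).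
  have dv : 0 < (deg (flip g) v)%:R :> F.
    by rewrite ltr0n (@deg_gt0 _ _ (flip g) v u).
  have := @agm_three ((deg g u)%:R / al) ((deg (flip g) v)%:R / be).
  rewrite !divr_gt0 // => /(_ isT isT) /le_trans; rewrite mulr1; apply.
  rewrite -[true%:R]/(1 : F).
  rewrite le_eqVlt; apply/orP; left; apply/eqP; field.
  by rewrite !gt_eqF.
have {}key : e <= W / (al * be).
  move: key; rewrite /al /be !divfK ?gt_eqF //; lra.
rewrite -subr_ge0; rewrite -subr_ge0 in key.
have -> : s * t * W - e ^+ 3 = e ^+ 2 * (W / (al * be) - e).
  by rewrite /al /be; field; rewrite !gt_eqF.
by rewrite mulr_ge0 // sqr_ge0.
Qed.

End Walks.

(* Sidorenko's inequality for the path with three edges *)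
Lemma nedges_walks (A B : finType) (g : A -> B -> bool) :
  nedges g ^ 3 <=
    #|A| * #|B| * \sum_u \sum_v g u v * (deg g u * deg (flip g) v).
Proof.
rewrite -(ler_nat rat) natrX !natrM.
apply: le_trans (nedges_walks_field rat g) _.
rewrite le_eqVlt natr_sum; apply/orP; left; apply/eqP; congr (_ * _)%R.
apply: eq_bigr => u _; rewrite natr_sum; apply: eq_bigr => v _.
by rewrite !natrM.
Qed.

(** * Hexagon-free bipartite graphs *)

Definition codeg (A : finType) (B : Type) (g : A -> B -> bool) (v w : B) : nat :=
  #|[set u | g u v && g u w]|.

(* the admissible ends of a three-edge path whose first edges end in v, u *)
Definition tame (A B : finType) (g : A -> B -> bool) (u : A) (v : B) : {set B} :=
  [set y | [&& g u y, y != v & codeg g v y <= 2]].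

Lemma exists_avoid (T : finType) (S : {set T}) (x y : T) :
  2 < #|S| -> exists z, [/\ z \in S, z != x & z != y].
Proof.
move=> S2; have : 0 < #|S :\: [set x; y]|.
  by rewrite cardsD; have := subset_leq_card (subsetIr S [set x; y]);
    rewrite cards2; case: (x != y); lia.
by case/card_gt0P => z; rewrite !inE negb_or => /andP[/andP[zx zy] zS]; exists z.
Qed.

(** Besides [v], at most one neighbour of [u] is lost: if [y] and [y'] both had at least three
    common neighbours with [v], some [a] and [a'] among these would complete the hexagon
    [u y a v a' y']. *)
Lemma card_tame (A B : finType) (g : A -> B -> bool) (u : A) (v : B) :
  hexagon_free g -> g u v -> deg g u - 2 <= #|tame g u v|.
Proof.
move=> gF guv; rewrite deg_card leq_subLR.
set X := [set y | [&& g u y, y != v & 2 < codeg g v y]].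
have X1 : #|X| <= 1.
  apply/card_le1_eqP => y y' yX y'X; apply/eqP; apply: contraT => yy'.
  move: yX y'X; rewrite !inE => /and3P[guy yv c] /and3P[guy' y'v c'].
  have [a [aS au _]] := exists_avoid u u c.
  have [a' [a'S a'u a'a]] := exists_avoid u a c'.
  move: aS a'S; rewrite !inE => /andP[gav gay] /andP[ga'v ga'y'].
  exfalso; apply: (gF u a a' y' y v) => //=.
    by rewrite !inE negb_or ![u == _]eq_sym au a'u eq_sym a'a.
  by rewrite !inE negb_or y'v yv yy'.
have : [set y | g u y] \subset [set v] :|: X :|: tame g u v.
  apply/subsetP => y; rewrite !inE => guy; rewrite guy /=.
  by case: (y == v) => //=; case: ltnP.
move=> /subset_leq_card /leq_trans; apply.
apply: leq_trans (leq_card_setU _ _) _; rewrite leq_add2r.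
by apply: leq_trans (leq_card_setU _ _) _; rewrite cards1 add1n ltnS.
Qed.

(** In a star of middle edges with centre [v0], the other ends are common neighbours of [v0] and
    [y]; with centre [u0], they are common neighbours of [u0] and [x]. Tameness leaves at most two
    in either case. *)
Lemma card_tame_pairs (A B : finType) (g : A -> B -> bool) (x : A) (y : B) :
  hexagon_free g ->
  #|[set p : A * B | [&& g p.1 p.2, y \in tame g p.1 p.2
                       & x \in tame (flip g) p.2 p.1]]| <= 2.
Proof.
move=> gF; set P := [set p | _].
have meet p q : p \in P -> q \in P -> p.1 = q.1 \/ p.2 = q.2.
  case: p q => [u v] [u' v']; rewrite !inE /= /flip.
  move=> /and3P[guv /and3P[guy yv _] /and3P[gxv xu _]].
  move=> /and3P[gu'v' /and3P[gu'y yv' _] /and3P[gxv' xu' _]].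
  have [->|uu'] := eqVneq u u'; first by left.
  have [->|vv'] := eqVneq v v'; first by right.
  exfalso; apply: (gF x u u' v' v y) => //=.
    by rewrite !inE negb_or xu xu' uu'.
  by rewrite !inE negb_or [v' == v]eq_sym vv' ![_ == y]eq_sym yv yv'.
have [->|/set0Pn[[u0 v0] p0]] := eqVneq P set0; first by rewrite cards0.
have [/existsP[[u1 v1] /andP[p1 /= vv]]|/existsPn allv] :=
  boolP [exists p, (p \in P) && (p.2 != v0)]; last first.
  have : P \subset [set (u, v0) | u in [set u | g u v0 && g u y]].
    apply/subsetP => [[u v]] uvP; have := allv (u, v); rewrite uvP /= negbK => /eqP vE.
    rewrite vE in uvP *; apply: imset_f; move: uvP; rewrite !inE /=.
    by case/and3P => -> /andP[->].
  move=> /subset_leq_card /leq_trans; apply.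
  apply: leq_trans (leq_imset_card _ _) _.
  by move: p0; rewrite !inE => /and3P[_ /and3P[]].
have : P \subset [set (u0, v) | v in [set v | g u0 v && g x v]].
  apply/subsetP => [[u v]] uvP.
  (* As [v1] differs from [v0], the centre is [u0]: an edge missing it would have to end in both
     [v0] and [v1]. *)
  have u1E : u1 = u0 by case: (meet _ _ p1 p0) => //= vE; rewrite vE eqxx in vv.
  have uE : u = u0.
    case: (meet _ _ uvP p0) => //= vE.
    case: (meet _ _ uvP p1) => /=; first by rewrite u1E.
    by rewrite vE => v01; rewrite v01 eqxx in vv.
  rewrite uE in uvP *; apply: imset_f; move: uvP; rewrite !inE /= /flip.
  by case/and3P => -> _ /and3P[->].
move=> /subset_leq_card /leq_trans; apply.
apply: leq_trans (leq_imset_card _ _) _.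
by move: p0; rewrite !inE => /and3P[_ _ /and3P[]].
Qed.

(** Double counting of the paths [x v u y] with tame ends: by the middle edge, where [card_tame]
    applies on both sides, and by the pair [(x, y)]. *)
Lemma sum_tame (A B : finType) (g : A -> B -> bool) :
  hexagon_free g ->
  \sum_u \sum_v g u v * ((deg g u - 2) * (deg (flip g) v - 2)) <= 2 * (#|A| * #|B|).
Proof.
move=> gF.
apply: (@leq_trans (\sum_u \sum_v g u v * (#|tame g u v| * #|tame (flip g) v u|))).
  apply: leq_sum => u _; apply: leq_sum => v _; case guv: (g u v) => //.
  rewrite !mul1n leq_mul // card_tame //; exact: hexagon_free_flip.
rewrite pair_big /=.
have -> : \sum_p g p.1 p.2 * (#|tame g p.1 p.2| * #|tame (flip g) p.2 p.1|) =
    \sum_(q : A * B) #|[set p : A * B | [&& g p.1 p.2, q.2 \in tame g p.1 p.2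
                       & q.1 \in tame (flip g) p.2 p.1]]|.
  under [RHS]eq_bigr => q _ do rewrite -sum1_card big_mkcond /=.
  rewrite exchange_big /=; apply: eq_bigr => p _.
  rewrite [#|tame g _ _| * _]mulnC -cardsX -sum1_card [X in _ * X]big_mkcond big_distrr /=.
  apply: eq_bigr => -[x y] _; rewrite in_setX (andbC (x \in _)).
  rewrite [X in _ = (if X then _ else _)]inE /=.
  by case: (g _ _) => //; case: ((y \in _) && _).
apply: (@leq_trans (\sum_(q : A * B) 2)).
  by apply: leq_sum => q _; apply: card_tame_pairs.
by rewrite sum_nat_const card_prod mulnC.
Qed.

(** An edge is deleted when it is among the first [k], in enumeration order, at either end. So a
    degree [d] falls to at most [d - k], truncated at 0, while at most [k] edges per vertex are
    lost. *)
Definition trim (A B : finType) (k : nat) (g : A -> B -> bool) (u : A) (v : B) :=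
  (v \in drop k (enum (g u))) && (u \in drop k (enum (flip g v))).

Lemma trim_sub (A B : finType) k (g : A -> B -> bool) u v : trim k g u v -> g u v.
Proof. by case/andP => /mem_drop; rewrite mem_enum. Qed.

Lemma flip_trim (A B : finType) k (g : A -> B -> bool) u v :
  flip (trim k g) v u = trim k (flip g) v u.
Proof. by rewrite /flip /trim andbC. Qed.

Lemma card_enum_deg (A : Type) (B : finType) (g : A -> B -> bool) u :
  size (enum (g u)) = deg g u.
Proof. by rewrite -cardE deg_card cardsE. Qed.

Lemma deg_trim (A B : finType) k (g : A -> B -> bool) u :
  deg (trim k g) u <= deg g u - k.
Proof.
rewrite deg_card -card_enum_deg -size_drop.
apply: leq_trans (card_size _); apply: subset_leq_card; apply/subsetP => v.
by rewrite inE => /andP[].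
Qed.

Lemma deg_flip_trim (A B : finType) k (g : A -> B -> bool) v :
  deg (flip (trim k g)) v <= deg (flip g) v - k.
Proof.
apply: leq_trans (deg_trim k (flip g) v).
by rewrite /deg; under eq_bigr do rewrite flip_trim.
Qed.

Lemma sum_take (A B : finType) k (g : A -> B -> bool) :
  \sum_u \sum_v (v \in take k (enum (g u))) <= k * #|A|.
Proof.
rewrite mulnC -sum_nat_const; apply: leq_sum => u _.
rewrite -/(deg (fun u v => v \in take k (enum (g u))) u) deg_card.
apply: leq_trans (_ : size (take k (enum (g u))) <= _); last by rewrite size_take; case: ltnP.
by apply: leq_trans (card_size _); apply: subset_leq_card; apply/subsetP => v; rewrite inE.
Qed.

Lemma nedges_trim (A B : finType) k (g : A -> B -> bool) :
  nedges g - (k * #|A| + k * #|B|) <= nedges (trim k g).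
Proof.
rewrite leq_subLR addnC.
apply: leq_trans (leq_add (leqnn _) (leq_add (sum_take k g) (sum_take k (flip g)))).
rewrite [X in _ + (_ + X)]exchange_big /= /nedges /deg -!big_split /=.
apply: leq_sum => u _; rewrite -!big_split /=; apply: leq_sum => v _.
case guv: (g u v) => //.
have h1 : v \in take k (enum (g u)) ++ drop k (enum (g u)).
  by rewrite cat_take_drop mem_enum.
have h2 : u \in take k (enum (flip g v)) ++ drop k (enum (flip g v)).
  by rewrite cat_take_drop mem_enum.
move: h1 h2; rewrite /trim !mem_cat.
by do 4?case: (_ \in _).
Qed.

(** Walks are counted in [trim 2 g], whose degrees are bounded by the weights that [sum_tame]
    controls in [g] itself. *)
Lemma nedges_hexagon_free (A B : finType) (g : A -> B -> bool) :
  hexagon_free g ->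
  (nedges g - (2 * #|A| + 2 * #|B|)) ^ 3 <= 2 * (#|A| * #|B|) ^ 2.
Proof.
move=> gF.
apply: (@leq_trans (nedges (trim 2 g) ^ 3)); first by rewrite leq_exp2r ?nedges_trim.
apply: leq_trans (nedges_walks _) _.
rewrite [X in _ <= X](_ : _ = #|A| * #|B| * (2 * (#|A| * #|B|))); last by ring.
rewrite leq_mul2l; apply/orP; right; apply: leq_trans (sum_tame gF).
apply: leq_sum => u _; apply: leq_sum => v _.
case h: (trim 2 g u v) => //; rewrite (trim_sub h) !mul1n.
by rewrite leq_mul ?deg_trim ?deg_flip_trim.
Qed.

(** * Links of pairs of vertices and their edges *)

Definition link (A B : eqType) (g : A -> B -> bool) (x : A) (y : B) :
    A -> B -> bool :=
  fun u v => [&& g u v, g x v && (v != y) & g u y && (u != x)].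

(** The parts are first restricted to the subtypes of N(y) - x and N(x) - y, so that degrees replace
    [#|A|] and [#|B|] in the hexagon-free bound. *)
Lemma nedges_link (A B : finType) (g : A -> B -> bool) (x : A) (y : B) :
  hexagon_free (link g x y) ->
  (nedges (link g x y) - 2 * (deg g x + deg (flip g) y)) ^ 3 <=
    2 * (deg g x * deg (flip g) y) ^ 2.
Proof.
move=> lF.
pose U := [pred u | g u y && (u != x)]; pose V := [pred v | g x v && (v != y)].
pose h (u : {u | U u}) (v : {v | V v}) := g (val u) (val v).
have hF : hexagon_free h.
  move=> u1 u2 u3 v1 v2 v3 Uu Uv h11 h12 h22 h23 h33 h31.
  have E u v : h u v -> link g x y (val u) (val v).
    by move=> huv; apply/and3P; split; [exact: huv|exact: (valP v)|exact: (valP u)].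
  by apply: (lF (val u1) (val u2) (val u3) (val v1) (val v2) (val v3)); rewrite ?E.
have -> : nedges (link g x y) = nedges h.
  rewrite /nedges /deg -(big_sub U (fun u => \sum_(v : {v | V v}) g u (val v))).
  rewrite [RHS]big_mkcond; apply: eq_bigr => u _; rewrite -(big_sub V (fun v => g u v : nat)).
  rewrite inE; case hu: (g u y && (u != x)); last first.
    by rewrite big1 // => v _; rewrite /link hu !andbF.
  rewrite [RHS]big_mkcond; apply: eq_bigr => v _.
  by rewrite /link hu inE andbT andbC; case: (g x v && _).
have cU : #|{: {u | U u}}| <= deg (flip g) y.
  rewrite card_sig deg_card; apply: subset_leq_card; apply/subsetP => u.
  by rewrite !inE => /andP[].
have cV : #|{: {v | V v}}| <= deg g x.
  rewrite card_sig deg_card; apply: subset_leq_card; apply/subsetP => v.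
  by rewrite !inE => /andP[].
apply: leq_trans (leq_trans (nedges_hexagon_free hF) _).
  by rewrite leq_exp2r // leq_sub2l // mulnDr addnC leq_add ?leq_mul2l ?cU ?cV ?orbT.
by rewrite leq_mul2l leq_exp2r // mulnC leq_mul.
Qed.

(** A walk [x v u y] with [u != x] and [v != y] has its middle edge in the link. Those with [u = x]
    number at most [deg g x], those with [v = y] at most [deg (flip g) y]. *)
Lemma walks_link (A B : finType) (g : A -> B -> bool) :
  \sum_u \sum_v g u v * (deg g u * deg (flip g) v) <=
    \sum_x \sum_y (nedges (link g x y) + (deg g x + deg (flip g) y)).
Proof.
have -> : \sum_u \sum_v g u v * (deg g u * deg (flip g) v) =
    \sum_x \sum_y \sum_u \sum_v g u v * (g u y * g x v).
  transitivity (\sum_u \sum_v \sum_x \sum_y g u v * (g u y * g x v)).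
    apply: eq_bigr => u _; apply: eq_bigr => v _.
    rewrite /deg big_distrlr /= exchange_big /= big_distrr /=.
    by apply: eq_bigr => x _; rewrite big_distrr.
  under eq_bigr do rewrite exchange_big /=.
  rewrite exchange_big /=; apply: eq_bigr => x _.
  under eq_bigr do rewrite exchange_big /=.
  by rewrite exchange_big.
apply: leq_sum => x _; apply: leq_sum => y _.
rewrite /nedges.
(* The degrees become sums over all [(u, v)], so that the inequality can be checked term by term. *)
have -> : deg g x = \sum_u \sum_v (u == x) * g x v.
  rewrite (bigD1 x) //= eqxx [X in _ + X]big1 ?addn0; first by apply: eq_bigr => v _; rewrite mul1n.
  by move=> u /negPf ->; rewrite big1.
have -> : deg (flip g) y = \sum_u \sum_v (v == y) * g u y.
  apply: eq_bigr => u _; rewrite (bigD1 y) //= eqxx big1 ?addn0 ?mul1n //.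
  by move=> v /negPf ->.
rewrite -!big_split /=; apply: leq_sum => u _.
rewrite -!big_split /=; apply: leq_sum => v _.
have : link g x y u v || (u == x) || (v == y) || ~~ [&& g u v, g u y & g x v].
  by rewrite /link; case: (u == x); case: (v == y); case: (g u v);
     case: (g u y); case: (g x v).
case: (link g x y u v); case: (g u v); case: (g u y); case: (g x v);
  case: (u == x); case: (v == y) => //.
Qed.

(** * The edge bound for graphs with hexagon-free links *)

Section CubeFree.
Variable F : realFieldType.
Local Open Scope ring_scope.

(* (1 + 2r)/3 is the tangent of r^(2/3) at r = 1. *)
Lemma cube_root_tangent (z c r : F) :
  0 < c -> 0 <= r -> z ^+ 3 <= c ^+ 3 * r ^+ 2 -> z <= c * ((1 + 2 * r) / 3).
Proof.
move=> c0 r0 zr.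
have rhs0 : 0 <= c * ((1 + 2 * r) / 3) by apply: mulr_ge0; lra.
have [z0|z0] := lerP z 0; first exact: le_trans rhs0.
rewrite -(@ler_pXn2r _ 3) ?nnegrE //; last exact: ltW.
apply: le_trans zr _; rewrite exprMn; apply: ler_wpM2l; first by rewrite exprn_ge0 ?ltW.
rewrite -subr_ge0.
have -> : ((1 + 2 * r) / 3) ^+ 3 - r ^+ 2 = (1 - r) ^+ 2 * (1 + 8 * r) / 27 by field.
by apply: divr_ge0 => //; apply: mulr_ge0; [exact: sqr_ge0|lra].
Qed.

Lemma sum2_affine (A B : finType) (k p q : F) (X Y : A -> B -> F) :
  \sum_x \sum_y (k + p * X x y + q * Y x y) =
    k * (#|A|%:R * #|B|%:R) + p * (\sum_x \sum_y X x y) + q * (\sum_x \sum_y Y x y).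
Proof.
under eq_bigr do rewrite !big_split /= -!mulr_sumr sumr_const.
by rewrite !big_split /= -!mulr_sumr sumr_const -mulrnA -natrM mulr_natr mulnC.
Qed.

Lemma sum_degD (A B : finType) (g : A -> B -> bool) :
  \sum_x \sum_y ((deg g x)%:R + (deg (flip g) y)%:R) =
    (#|A|%:R + #|B|%:R) * (nedges g)%:R :> F.
Proof.
under eq_bigr do rewrite big_split /= sumr_const.
rewrite big_split /= sumr_const sumrMnl -!natr_sum -/(nedges g).
by rewrite -/(nedges (flip g)) nedges_flip mulrDl !mulr_natl addrC.
Qed.

Lemma sum_degM (A B : finType) (g : A -> B -> bool) :
  \sum_x \sum_y ((deg g x)%:R * (deg (flip g) y)%:R) = (nedges g)%:R ^+ 2 :> F.
Proof.
rewrite expr2 -[X in _ = _ * X%:R]nedges_flip /nedges !natr_sum mulr_suml.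
by apply: eq_bigr => x _; rewrite mulr_sumr.
Qed.

(** [M] is the main term of the bound, given by its fifth power to stay within field arithmetic. *)
Lemma nedges_link_free (A B : finType) (g : A -> B -> bool) (M : F) :
  (forall x y, hexagon_free (link g x y)) ->
  0 < M -> M ^+ 5 = 2 * (#|A|%:R * #|B|%:R) ^+ 4 -> M <= (nedges g)%:R ->
  ((nedges g)%:R - M) ^+ 2 <= 3 * (#|A|%:R * #|B|%:R) * (#|A|%:R + #|B|%:R).
Proof.
move=> gF M0 M5 Me.
set e : F := (nedges g)%:R in Me *; set n : F := #|A|%:R * #|B|%:R in M5 *.
have e0 : 0 < e by apply: lt_le_trans Me.
have n0 : 0 < n.
  rewrite lt_def /n mulr_ge0 // andbT; apply: contraTneq M0 => n0.
  by move: M5; rewrite -/n in n0 *; rewrite n0 expr0n mulr0 => /eqP;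
     rewrite expf_eq0 => /andP[_ /eqP ->]; rewrite ltxx.
(* [r x y] is [d(x) d(y)] divided by its average, and [c] is at least the cube
   root of 2 (e^2/n)^2, which is where [M <= e] is used. *)
pose c := M * e ^+ 2 / n ^+ 2.
have c0 : 0 < c.
  by apply: divr_gt0; last exact: exprn_gt0; apply: mulr_gt0 => //; exact: exprn_gt0.
pose r x y : F := (deg g x)%:R * (deg (flip g) y)%:R * (n / e ^+ 2).
have r0 x y : 0 <= r x y.
  apply: mulr_ge0; first exact: mulr_ge0.
  by apply: divr_ge0; [exact: ltW | exact: sqr_ge0].
have link_le x y : (nedges (link g x y))%:R <=
    c * ((1 + 2 * r x y) / 3) + 2 * ((deg g x)%:R + (deg (flip g) y)%:R).
  rewrite -lerBlDr; have := nedges_link (gF x y).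
  set w := (2 * _)%N => lz.
  have wE : 2 * ((deg g x)%:R + (deg (flip g) y)%:R) = w%:R :> F.
    by rewrite /w natrM natrD.
  (* Truncation only increases a difference, so the bound on naturals passes to the field. *)
  rewrite wE; apply: (@le_trans _ _ (nedges (link g x y) - w)%:R).
    by rewrite lerBlDr -natrD ler_nat addnC -leq_subLR.
  apply: cube_root_tangent => //; rewrite -natrX.
  apply: (@le_trans _ _ (2 * (deg g x * deg (flip g) y) ^ 2)%:R); first by rewrite ler_nat.
  rewrite natrM natrX natrM; set d : F := (deg g x)%:R * _.
  have -> : c ^+ 3 * (r x y) ^+ 2 = M ^+ 3 * e ^+ 2 / n ^+ 4 * d ^+ 2.
    by rewrite /c /r -/d; field; rewrite !gt_eqF.
  apply: ler_wpM2r; first exact: sqr_ge0.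
  (* Here [2 n^4 = M^5 = M^3 M^2], which is at most [M^3 e^2]. *)
  rewrite ler_pdivlMr ?exprn_gt0 // -M5.
  rewrite -[M ^+ 5]/(M ^+ (3 + 2)) exprD ler_pM2l ?exprn_gt0 //.
  by rewrite ler_sqr // nnegrE ltW.
have walks : (\sum_u \sum_v g u v * (deg g u * deg (flip g) v))%:R <=
    M * e ^+ 2 / n + 3 * (#|A|%:R + #|B|%:R) * e.
  apply: (@le_trans _ _ (\sum_x \sum_y (nedges (link g x y) + (deg g x + deg (flip g) y)))%:R).
    by rewrite ler_nat walks_link.
  (* The coefficient 3 is 2 from the links plus 1 from the degenerate walks. Since [r] averages to
     1, the tangent terms sum to [c n = M e^2 / n]. *)
  rewrite natr_sum; apply: (@le_trans _ _ (\sum_x \sum_y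
     (c / 3 + 2 / 3 * c * (n / e ^+ 2) * ((deg g x)%:R * (deg (flip g) y)%:R) +
      3 * ((deg g x)%:R + (deg (flip g) y)%:R)))).
    apply: ler_sum => x _; rewrite natr_sum; apply: ler_sum => y _.
    rewrite !natrD; have := link_le x y; rewrite /r; lra.
  rewrite sum2_affine sum_degM sum_degD -/e -/n.
  by rewrite le_eqVlt; apply/orP; left; apply/eqP; rewrite /c; field; rewrite !gt_eqF.
have : e ^+ 3 <= n * (M * e ^+ 2 / n + 3 * (#|A|%:R + #|B|%:R) * e).
  apply: le_trans (_ : n * (\sum_u \sum_v g u v * (deg g u * deg (flip g) v))%:R <= _).
    by rewrite /e /n -natrX -!natrM ler_nat nedges_walks.
  by rewrite ler_pM2l.
have -> : n * (M * e ^+ 2 / n + 3 * (#|A|%:R + #|B|%:R) * e) =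
    (M * e + 3 * n * (#|A|%:R + #|B|%:R)) * e by field; rewrite gt_eqF.
(* With a factor [e] cancelled, [h] bounds [e (e - M)] by the right side, and
   [(e - M)^2 <= e (e - M)] because [0 < M <= e]. *)
rewrite exprSr ler_pM2r // => h; nra.
Qed.
End CubeFree.

(** * From set systems to relations: cubes and edge counts *)

Section Embedding.
Variables (A B T : finType) (i : A -> T) (j : B -> T) (E : {set {set T}}).
Let g u v := [set i u; j v] \in E.

(* If x is the vertex 000 of the cube and y the vertex 111, the other six
   vertices form a hexagon. *)
Lemma cube_free_link (x : A) (y : B) :
  injective i -> injective j -> (forall u v, i u != j v) ->
  Defs.free cube E -> hexagon_free (link g x y).
Proof.
move=> iI jI ij Efree u1 u2 u3 v1 v2 v3 Uu Uv.
move=> /and3P[g11 /andP[gx1 v1y] /andP[g1y u1x]] /and3P[g12 /andP[gx2 v2y] _].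
move=> /and3P[g22 _ /andP[g2y u2x]] /and3P[g23 /andP[gx3 v3y] _].
move=> /and3P[g33 _ /andP[g3y u3x]] /and3P[g31 _ _].
(* The images are listed by the binary value [c] of the cube vertex; vertices with an even number of
   ones go to the side of [i]. *)
pose s := [:: i x; j v3; j v2; i u2; j v1; i u3; i u1; j y].
pose c (p : {ffun 'I_3 -> bool}) : nat := p ord0 * 4 + p (inord 1) * 2 + p (inord 2).
have sU : uniq s.
  move: Uu Uv; rewrite /s /= !inE !(inj_eq iI) !(inj_eq jI).
  do ![rewrite (negPf (ij _ _)) | rewrite [j _ == i _]eq_sym (negPf (ij _ _))].
  rewrite ![x == _]eq_sym (negPf u1x) (negPf u2x) (negPf u3x).
  rewrite (negPf v1y) (negPf v2y) (negPf v3y).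
  rewrite [u2 == u1]eq_sym [u3 == u1]eq_sym [v3 == v2]eq_sym [v3 == v1]eq_sym [v2 == v1]eq_sym.
  by case: (u1 == u2); case: (u1 == u3); case: (u2 == u3);
     case: (v1 == v2); case: (v1 == v3); case: (v2 == v3).
have ord3 (k : 'I_3) : [\/ k = ord0, k = inord 1 | k = inord 2].
  case: k => [[|[|[|//]]] h]; [constructor 1|constructor 2|constructor 3];
  by apply: val_inj; rewrite /= ?inordK.
have cI : injective c.
  move=> p q; rewrite /c => pq; apply/ffunP => k.
  by move: pq; case: (ord3 k) => ->;
     case: (p ord0); case: (q ord0); case: (p (inord 1)); case: (q (inord 1));
     case: (p (inord 2)); case: (q (inord 2)).
have c8 p : c p < size s.
  by rewrite /c; case: (p ord0); case: (p (inord 1)); case: (p (inord 2)).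
pose f := [ffun p : {ffun 'I_3 -> bool} => nth (i x) s (c p)].
move/negP: Efree; apply; apply/existsP; exists f; apply/andP; split.
  apply/injectiveP => p q; rewrite !ffunE => /eqP.
  by rewrite nth_uniq // => /eqP /cI.
apply/forall_inP => _ /imsetP[[p q] /= pq ->].
rewrite imsetU !imset_set1 !ffunE.
move: pq; rewrite inE /cube_adj /= -sum1dep_card big_mkcond /= !big_ord_recl big_ord0 /=.
have -> : lift ord0 ord0 = inord 1 :> 'I_3 by apply: val_inj; rewrite /= inordK.
have -> : lift ord0 (lift ord0 ord0) = inord 2 :> 'I_3 by apply: val_inj; rewrite /= inordK.
rewrite /c.
(* For adjacent [p] and [q] the image is a hexagon edge or an edge at [x] or [y], up to exchanging
   its ends. *)
by case: (p ord0); case: (q ord0); case: (p (inord 1)); case: (q (inord 1));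
   case: (p (inord 2)); case: (q (inord 2)) => //= _ //; rewrite setUC.
Qed.

(** [E'] will be the whole edge set in the bipartite case and a cut in the general case. *)
Lemma card_le_nedges (E' : {set {set T}}) :
  E' \subset E -> (forall e, e \in E' -> exists u v, e = [set i u; j v]) ->
  #|E'| <= nedges g.
Proof.
move=> /subsetP E'E eE.
have -> : nedges g = #|[set p : A * B | g p.1 p.2]|.
  rewrite /nedges /deg pair_big -sum1dep_card [RHS]big_mkcond.
  by apply: eq_bigr => p _; case: (g _ _).
apply: leq_trans (leq_imset_card (fun p : A * B => [set i p.1; j p.2]) _).
apply/subset_leq_card/subsetP => e eE'; have [u [v ev]] := eE _ eE'.
by rewrite ev; apply/imsetP; exists (u, v) => //; rewrite inE /g /= -ev E'E.
Qed.

End Embedding.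

(** * Cuts with at least half of the edges *)

Section Cut.
Variables (T : finType) (E : {set {set T}}).

Definition cut (S : {set T}) : {set {set T}} := [set e in E | #|e :&: S| == 1].

Lemma card_pair_setI (u v : T) (S : {set T}) :
  u != v -> #|[set u; v] :&: S| = (u \in S) + (v \in S).
Proof.
move=> uv; rewrite setIUl cardsU !(setIC _ S).
have -> : S :&: [set u] :&: (S :&: [set v]) = set0.
  apply/setP => w; rewrite !inE; case: (w \in S) => //=.
  by case: eqVneq => // ->; rewrite (negPf uv).
have c1 w : #|S :&: [set w]| = (w \in S).
  have [wS|wS] := boolP (w \in S); first by rewrite (setIidPr _) ?cards1 ?sub1set.
  by apply/eqP; rewrite cards_eq0 setI_eq0 disjoint_sym disjoints1.
by rewrite !c1 cards0 subn0.
Qed.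

(* moving one end of an edge across the cut toggles whether the edge is cut *)
Lemma card_cutting (e : {set T}) :
  #|e| = 2 -> 2 * \sum_(S : {set T}) (#|e :&: S| == 1) = #|{set T}|.
Proof.
move/eqP/cards2P => [u [v [uv ->]]].
pose t (S : {set T}) := if u \in S then S :\ u else u |: S.
have tK : involutive t.
  move=> S; rewrite /t; have [uS|uS] := boolP (u \in S).
    by rewrite !inE eqxx /= setD1K.
  by rewrite !inE eqxx /= setU1K.
rewrite mul2n -addnn {1}(reindex_inj (inv_inj tK)) -big_split /= -sum1_card.
apply: eq_bigr => S _; rewrite !card_pair_setI // /t.
have [uS|uS] := boolP (u \in S); rewrite !inE eqxx [v == u]eq_sym (negPf uv) /=;
  by case: (v \in S).
Qed.

(** Averaging over all [S]: by [card_cutting] each edge is cut by exactly half of the sets. *)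
Lemma exists_cut : simple_graph E -> exists S, #|E| <= 2 * #|cut S|.
Proof.
move=> /forall_inP E2.
have [/existsP //|/existsPn noS] := boolP [exists S, #|E| <= 2 * #|cut S|].
exfalso.
have cutE S : #|cut S| = \sum_(e in E) (#|e :&: S| == 1).
  rewrite -sum1_card big_mkcond [RHS]big_mkcond; apply: eq_bigr => e _.
  by rewrite inE; case: (e \in E) => //=; case: (_ == 1).
have : \sum_(S : {set T}) (2 * #|cut S|).+1 <= \sum_(S : {set T}) #|E|.
  by apply: leq_sum => S _; rewrite ltnNge noS.
rewrite (eq_bigr (fun S => 1 + 2 * #|cut S|)) // big_split /= sum1_card -big_distrr /=.
rewrite (eq_bigr _ (fun S _ => cutE S)) exchange_big big_distrr /=.
rewrite (eq_bigr (fun _ => #|{set T}|)); last first.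
  by move=> e eE; apply: card_cutting; apply/eqP/E2.
rewrite !sum_nat_const mulnC leqNgt => /negP; apply.
(* The excess is the number of sets [S], which is positive because of [set0]. *)
by rewrite -[X in X < _]add0n ltn_add2r; apply/card_gt0P; exists set0.
Qed.

Lemma cut_ends (S : {set T}) e : simple_graph E -> e \in cut S ->
  exists (u : {u | u \in S}) (v : {v | v \notin S}), e = [set val u; val v].
Proof.
move=> /forall_inP E2; rewrite inE => /andP[eE].
have /cards2P[u [v [uv ->]]] := E2 _ eE.
rewrite card_pair_setI //.
have [uS|uS] := boolP (u \in S); have [vS|vS] := boolP (v \in S) => // _.
  by exists (exist _ u uS), (exist _ v vS).
by exists (exist _ v vS), (exist _ u uS); rewrite setUC.
Qed.

End Cut.

(** * Explicit bounds with real powers *)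

Section Bounds.
Variable R : realType.
Local Open Scope ring_scope.

Definition bip_bound (a b : R) : R :=
  2 `^ (1 / 5) * (a * b) `^ (4 / 5) + 9 * (a * b `^ (1 / 2) + a `^ (1 / 2) * b).

Lemma bip_bound_ge0 (a b : R) : 0 <= a -> 0 <= b -> 0 <= bip_bound a b.
Proof. by move=> a0 b0; rewrite addr_ge0 ?mulr_ge0 ?addr_ge0 ?mulr_ge0 ?powR_ge0. Qed.

Lemma powR_half (a : R) : 0 <= a -> a `^ (1 / 2) = Num.sqrt a.
Proof. by move=> a0; rewrite mul1r powR12_sqrt. Qed.

(** Above [M], [nedges_link_free] bounds the square of the excess by [3 a b (a + b)]; the constant 9
    leaves ample room, as the square root of 3 would do. *)
Lemma nedges_le_bip_bound (A B : finType) (g : A -> B -> bool) :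
  (forall x y, hexagon_free (link g x y)) ->
  (nedges g)%:R <= bip_bound #|A|%:R #|B|%:R.
Proof.
move=> gF; set a : R := #|A|%:R; set b : R := #|B|%:R.
have a0 : 0 <= a by []. have b0 : 0 <= b by [].
have [e0|e0] := eqVneq (nedges g) 0%N; first by rewrite e0 bip_bound_ge0.
have A0 : 0 < a.
  rewrite /a ltr0n lt0n; apply: contraNneq e0 => /card0_eq A0.
  by rewrite /nedges big1 // => u; have := A0 u; rewrite inE.
have B0 : 0 < b.
  rewrite ltr0n lt0n; apply: contraNneq e0 => /card0_eq B0.
  rewrite -nedges_flip /nedges big1 // => u; have := B0 u; by rewrite inE.
set M := 2 `^ (1 / 5) * (a * b) `^ (4 / 5).
have M0 : 0 < M by rewrite mulr_gt0 ?powR_gt0 ?mulr_gt0.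
have M5 : M ^+ 5 = 2 * (a * b) ^+ 4.
  rewrite /M exprMn -!powR_mulrn ?powR_ge0 // -?powRrM ?mulr_ge0 //.
  have -> : 1 / 5 * 5%:R = 1 :> R by field.
  have -> : 4 / 5 * 5%:R = 4%:R :> R by field.
  by rewrite powRr1.
rewrite /bip_bound -/M !powR_half //.
have sa := sqr_sqrtr a0; have sb := sqr_sqrtr b0.
have sa0 := sqrtr_ge0 a; have sb0 := sqrtr_ge0 b.
set x := Num.sqrt a in sa sa0 *; set y := Num.sqrt b in sb sb0 *.
rewrite -lerBlDl; have [Me|Me] := lerP M (nedges g)%:R; last first.
  by apply: (@le_trans _ _ 0); [lra|rewrite !(mulr_ge0, addr_ge0)].
have := nedges_link_free gF M0 M5 Me; rewrite -/a -/b => h.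
have [d0|d0] := lerP ((nedges g)%:R - M) 0.
  by apply: le_trans d0 _; rewrite !(mulr_ge0, addr_ge0).
have rhs0 : 0 <= 9 * (x ^+ 2 * y + x * y ^+ 2).
  by rewrite !(mulr_ge0, addr_ge0, sqr_ge0).
move/ltW in d0; rewrite -sa -sb -ler_sqr ?nnegrE //.
apply: le_trans h _; rewrite -[in leLHS]sa -[in leLHS]sb.
have -> : (9 * (x ^+ 2 * y + x * y ^+ 2)) ^+ 2 =
  3 * (x ^+ 2 * y ^+ 2) * (x ^+ 2 + y ^+ 2)
  + (x * y) ^+ 2 * (78 * x ^+ 2 + 78 * y ^+ 2 + 162 * (x * y)) by ring.
by rewrite lerDl mulr_ge0 ?sqr_ge0 // !addr_ge0 // !mulr_ge0 // sqr_ge0.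
Qed.

(** The factor 2 pays for passing to a cut. The main term follows from [a b <= n^2 / 4]; the error
    term is largest at [a = b = n / 2], where its coefficient is 9 times the square root of 2, just
    below 13. *)
Lemma bip_bound_double (a b n : R) : 0 <= a -> 0 <= b -> a + b = n ->
  2 * bip_bound a b <= 2 `^ (- (2 / 5)) * n `^ (8 / 5) + 13 * n `^ (3 / 2).
Proof.
move=> a0 b0 abn.
have n0 : 0 <= n by rewrite -abn addr_ge0.
rewrite mulrDr; apply: lerD.
  have -> : 2 `^ (- (2 / 5)) * n `^ (8 / 5) = 2 * (2 `^ (1 / 5) * (n ^+ 2 / 4) `^ (4 / 5)) :> R.
    have -> : n ^+ 2 / 4 = n `^ 2 * 2 `^ (- 2).
      by rewrite powR_mulrn // powR_invn //; congr (_ * _^-1); ring.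
    rewrite powRM ?powR_ge0 // -!powRrM.
    have -> : 2 * (4 / 5) = 8 / 5 :> R by field.
    have -> : - (2 / 5) = 1 + (1 / 5 + - 2 * (4 / 5)) :> R by field.
    rewrite 2?powRD ?pnatr_eq0 ?implybT // powRr1 //; ring.
  rewrite !ler_pM2l ?powR_gt0 //.
  apply: ge0_ler_powR; rewrite ?nnegrE ?mulr_ge0 ?divr_ge0 ?sqr_ge0 ?invr_ge0 //.
  have := sqr_ge0 (a - b); rewrite -abn; lra.
have -> : n `^ (3 / 2) = n * Num.sqrt n.
  have [->|nn0] := eqVneq n 0; first by rewrite mul0r powR0 //; lra.
  have -> : 3 / 2 = 1 + 2^-1 :> R by field.
  by rewrite powRD ?nn0 ?implybT // powRr1 // powR12_sqrt.
rewrite !powR_half //.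
have sa := sqr_sqrtr a0; have sb := sqr_sqrtr b0; have sn := sqr_sqrtr n0.
have sa0 := sqrtr_ge0 a; have sb0 := sqrtr_ge0 b; have sn0 := sqrtr_ge0 n.
rewrite -[X in 13 * (X * _)]sn -[X in 9 * (X * _ + _)]sa -[X in 9 * (_ + _ * X)]sb.
move: sn; rewrite -abn -{2}sa -{2}sb.
move: sa0 sb0 sn0; rewrite abn.
move: (Num.sqrt a) (Num.sqrt b) (Num.sqrt n) => x y z x0 y0 z0 zE.
rewrite -ler_sqr ?nnegrE ?(mulr_ge0, addr_ge0, sqr_ge0) //.
have -> : (13 * (z ^+ 2 * z)) ^+ 2 = 169 * (z ^+ 2) ^+ 3 by ring.
rewrite zE -subr_ge0.
(* Splitting 169 = 7 + 162 isolates the multiple for which equality holds at [x = y]; that part is a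
   combination of squares vanishing there. *)
have -> : 169 * (x ^+ 2 + y ^+ 2) ^+ 3 - (2 * (9 * (x ^+ 2 * y + x * y ^+ 2))) ^+ 2 =
  7 * (x ^+ 2 + y ^+ 2) ^+ 3 + 162 * ((x ^+ 2 - y ^+ 2) ^+ 2 * (x ^+ 2 + y ^+ 2)
    + (x * y) ^+ 2 * (2 * (x - y) ^+ 2)) by ring.
have w0 : 0 <= x ^+ 2 + y ^+ 2 by rewrite addr_ge0 ?sqr_ge0.
apply: addr_ge0; apply: mulr_ge0 => //; first exact: exprn_ge0.
apply: addr_ge0; apply: mulr_ge0; rewrite ?sqr_ge0 //.
by rewrite mulr_ge0 ?sqr_ge0.
Qed.

End Bounds.

Local Open Scope ring_scope.

Theorem theorem8 (R : realType) :
  (forall a b : nat, (0 < a)%N -> (0 < b)%N ->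
    (turan_bip a b cube)%:R <=
      2 `^ (1 / 5) * (a%:R * b%:R) `^ (4 / 5)
      + 9 * (a%:R * b%:R `^ (1 / 2) + a%:R `^ (1 / 2) * b%:R) :> R) /\
  (forall n : nat, (0 < n)%N ->
    (turan n cube)%:R <=
      2 `^ (- (2 / 5)) * n%:R `^ (8 / 5) + 13 * n%:R `^ (3 / 2) :> R).
Proof.
split=> [a b _ _|n _].
  rewrite -/(bip_bound a%:R b%:R) /turan_bip.
  (* A bound on a maximum is checked at 0, under binary maxima and for each admissible [E]. *)
  elim/big_ind: _ => [|p q hp hq|E /andP[Ebip Efree]]; first exact: bip_bound_ge0.
    by rewrite /maxn; case: ifP.
  have := @nedges_le_bip_bound R _ _ (fun (u : 'I_a) (v : 'I_b) => [set inl u; inr v] \in E).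
  rewrite !card_ord => h; apply: le_trans (h _).
    rewrite ler_nat; apply: (card_le_nedges (subxx E)) => e /(subsetP Ebip).
    by case/imset2P => u v _ _ ->; exists u, v.
  by move=> x y; apply: cube_free_link => // [u v []|u v []].
rewrite /turan; elim/big_ind: _ => [|p q hp hq|E /andP[Esimple Efree]].
- by rewrite addr_ge0 ?mulr_ge0 ?powR_ge0.
- by rewrite /maxn; case: ifP.
have [S ES] := exists_cut Esimple.
(* The two sides of the cut become the parts, embedded by [val]; their sizes add up to [n]. *)
pose g (u : {u | u \in S}) (v : {v | v \notin S}) := [set val u; val v] \in E.
have gF x y : hexagon_free (link g x y).
  apply: cube_free_link => //; try exact: val_inj.
  move=> u v; apply: contraTneq (valP u) => ->; exact: (valP v).
have cutg : (#|cut E S| <= nedges g)%N.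
  apply: card_le_nedges => [|e]; last exact: cut_ends.
  by apply/subsetP => e; rewrite inE => /andP[].
apply: (@le_trans _ _ (2 * (nedges g)%:R)).
  by rewrite -natrM ler_nat; apply: leq_trans ES _; rewrite leq_mul2l cutg.
have h := nedges_le_bip_bound R gF.
apply: le_trans (bip_bound_double _ _ _); first by rewrite ler_pM2l //; exact: h.
- by [].
- by [].
rewrite -natrD !card_sig; congr (_%:R).
by rewrite -[RHS](card_ord n) -(cardC [in S]); congr (_ + _)%N; apply: eq_card => u; rewrite !inE.
Qed.
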